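(* Let $E:\mathbb{R}^d\to GL(\mathbb{R}^d)$ be an admissible exponent, $\sigma$ a finite symmetric measure on $\mathbb{S}^{d-1}$, and let $q(x,\xi)=\int_{\mathbb{R}^d\setminus\{0\}}(1-\cos(\langle y,\xi\rangle))\,\phi_x(dy)$ be the symbol of the corresponding operator-stable-like process. Then for all $t>0$ and all $x,\xi\in\mathbb{R}^d$ $$q(x,t^{E(x)}\xi)=t\,q(x,\xi).$$
   Context: $\|\cdot\|$ is the Euclidean norm on $\mathbb{R}^d$ and also the induced operator norm on $d\times d$ matrices; $\langle\cdot,\cdot\rangle$ is the Euclidean scalar product; $\mathbb{S}^{d-1}$ is the Euclidean unit sphere. For $r>0$ and a matrix $A$, $r^A:=\exp(A\ln r)$. $\lambda(x)$ denotes the minimum of the real parts of the eigenvalues of $E(x)$. Admissible exponent: a map $E:\mathbb{R}^d\to GL(\mathbb{R}^d)$ such that (E1) $E(x)$ is symmetric for every $x$; (E2) there is a constant $C>0$ with $\|E(y)-E(x)\|\le C\|y-x\|$ for all $x,y\in\mathbb{R}^d$; (E3) there is a constant $a>1/2$ with $a\le\lambda(x)$ for all $x\in\mathbb{R}^d$. The operator-stable-like L\'evy measure with exponent $E(x)$ and spherical measure $\sigma$ is $$\phi_x(A)=\int_{\mathbb{S}^{d-1}}\int_0^\infty1_A(r^{E(x)}\theta)\,\frac{dr}{r^2}\,\sigma(d\theta),\qquad A\subset\mathbb{R}^d\setminus\{0\}\text{ Borel};$$ symmetric means $\sigma(A)=\sigma(-A)$ for all Borel $A\subset\mathbb{S}^{d-1}$.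 An operator-stable-like (OSL) process is a Markov semimartingale whose symbol is $q(x,\xi)=\int_{\mathbb{R}^d\setminus\{0\}}(1-\cos(\langle y,\xi\rangle))\,\phi_x(dy)$, where $\phi_x$ is the operator-stable-like L\'evy measure with exponent $E(x)$ and symmetric spherical measure $\sigma$. *)

(* Defs.v *)
From HB Require Import structures.
From mathcomp Require Import all_boot all_order all_algebra.
From mathcomp Require Import complex.
From mathcomp Require Import all_classical all_reals all_analysis.
From mathcomp Require Import measurable_realfun.

Set Implicit Arguments.
Unset Strict Implicit.
Unset Printing Implicit Defensive.

Import Order.TTheory GRing.Theory Num.Theory.
Import numFieldNormedType.Exports.

Local Open Scope classical_set_scope.
Local Open Scope ring_scope.

Section euclidean.
Context {R : realType} {d : nat}.
Implicit Types (u v : 'cV[R]_d) (A : 'M[R]_d).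

Definition inner u v : R := \sum_i u i ord0 * v i ord0.

(* The norm that MathComp-Analysis puts on matrices is the sup norm. *)
Definition enorm v : R := Num.sqrt (inner v v).

Definition sphere : set 'cV[R]_d := [set v | enorm v = 1].

Definition opnorm A : R :=
  sup [set enorm (A *m v) | v in [set v | enorm v <= 1]].

(* The set is finite, and nonempty for 0 < d, so that the infimum is then a
   minimum. *)
Definition min_re_eigenvalue A : R :=
  inf [set complex.Re z |
       z in [set z : R[i] | eigenvalue (map_mx (real_complex R) A) z]].

(* The limit of the partial sums in 'M_d is taken entry by entry. *)
Definition expmx A : 'M[R]_d :=
  \matrix_(i, j) limn (series (fun k => (A ^+ k) i j / k`!%:R)).

Definition powmx (r : R) A : 'M[R]_d := expmx (ln r *: A).

Record admissible (E : 'cV[R]_d -> 'M[R]_d) : Prop := Admissible {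
  admissible_unit : forall x, E x \in unitmx;
  admissible_sym : forall x, (E x)^T = E x;
  admissible_lipschitz : exists2 C : R, 0 < C &
    forall x y, opnorm (E y - E x) <= C * enorm (y - x);
  admissible_lower : exists2 a : R, 1 / 2 < a &
    forall x, a <= min_re_eigenvalue (E x) }.

End euclidean.

Definition borelV (R : realType) (d : nat) :=
  g_sigma_algebraType (@open 'cV[R]_d).

Section borel_measurability.
Context {R : realType} {d : nat}.

Lemma measurable_coord (i : 'I_d) :
  measurable_fun setT (fun v : borelV R d => (v : 'cV[R]_d) i ord0).
Proof.
apply: (measurability _ (RGenOpens.measurableE R)).
move=> _ [_ [a [b ->]] <-]; rewrite setTI; apply: sub_sigma_algebra.
rewrite openE => v /= vab.
exists (fun k l => if k == i then `]a, b[%classic : set R else setT).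
  move=> k l; case: eqP => [->|_]; last exact: filterT.
  by rewrite (ord1 l); apply: open_nbhs_nbhs; split => //; exact: interval_open.
by move=> w /(_ i ord0); rewrite eqxx.
Qed.

Let box (ab : 'cV[rat]_d * 'cV[rat]_d) : set 'cV[R]_d :=
  [set v | forall i, v i ord0 \in `]ratr (ab.1 i ord0), ratr (ab.2 i ord0)[].

Let open_box (U : set 'cV[R]_d) : open U ->
  U = \bigcup_ab (if `[< box ab `<=` U >] then box ab else set0).
Proof.
move=> oU; apply/seteqP; split => [v Uv|v [ab _]]; last first.
  by case: asboolP => // abU /abU.
have [P vP PU] : nbhs v U by exact: open_nbhs_nbhs.
have rP i : exists ab : rat * rat, (v i ord0 \in `]ratr ab.1, ratr ab.2[) /\
    [set` `](ratr ab.1 : R), ratr ab.2[ ] `<=` P i ord0.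
  have /nbhs_ballP[e /= e0 eP] := vP i ord0.
  have /rat_in_itvoo[a] : v i ord0 - e < v i ord0 by rewrite ltrBlDr ltrDl.
  have /rat_in_itvoo[b] : v i ord0 < v i ord0 + e by rewrite ltrDl.
  rewrite !in_itv/= => /andP[vb be] /andP[ae av]; exists (a, b).
  rewrite in_itv/= av vb; split=> // x /=; rewrite in_itv/= => /andP[ax xb].
  apply: eP; rewrite /ball/= distrC ltr_distl.
  by rewrite (lt_trans ae ax) (lt_trans xb be).
have [f fP] := choice rP.
exists (\col_i (f i).1, \col_i (f i).2) => //.
case: asboolP => [_|nU]; first by move=> i /=; rewrite !mxE; case: (fP i).
apply: nU => w /= wf; apply: PU => i j; rewrite (ord1 j).
by apply: (fP i).2; have := wf i; rewrite !mxE.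
Qed.

Lemma measurable_borelV dX (X : measurableType dX) (f : X -> borelV R d) :
  (forall i, measurable_fun setT (fun x => (f x : 'cV[R]_d) i ord0)) ->
  measurable_fun setT f.
Proof.
move=> mf.
apply: (@measurability _ _ _ (borelV R d) _ _ (@open 'cV[R]_d)) => //=.
move=> _ [U /open_box -> <-]; rewrite setTI preimage_bigcup.
apply: countable_bigcupT_measurable => [|ab]; first exact: countableP.
case: asboolP => _; last by rewrite preimage_set0.
rewrite (_ : _ @^-1` _ = \bigcap_(i in [set: 'I_d])
    (fun x => (f x : 'cV[R]_d) i ord0)
      @^-1` [set` `]ratr (ab.1 i ord0), ratr (ab.2 i ord0)[]); last first.
  by apply/seteqP; split => x /= xab; [move=> i _|move=> i]; apply: xab.
apply: fin_bigcap_measurable => [|i _]; first exact: finite_finset.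
by rewrite -[X in measurable X]setTI; apply: mf => //; exact: measurable_itv.
Qed.

Lemma measurable_sphere : measurable (sphere : set (borelV R d)).
Proof.
have mi : measurable_fun setT
    (fun v : borelV R d => inner (v : 'cV[R]_d) v : measurableTypeR R).
  by apply: measurable_sum => i; apply: measurable_funM; exact: measurable_coord.
have me : measurable_fun setT (fun v : borelV R d => enorm (v : 'cV[R]_d)).
  apply: (@measurableT_comp _ _ _ _ _ _ (@Num.sqrt R)) => //.
  by apply: continuous_measurable_fun; exact: sqrt_continuous.
rewrite -[X in measurable X]setTI.
exact: (me measurableT [set 1] (measurable_set1 _)).
Qed.

End borel_measurability.

Section matrix_power_measurability.
Context {R : realType} {d : nat}.
Implicit Types A : 'M[R]_d.

Lemma cvg_expmx A i j : cvgn (series (fun k => (A ^+ k) i j / k`!%:R)).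
Proof.
pose c : R := \sum_k \sum_l `|A k l|.
have c0 : 0 <= c by do 2!apply: sumr_ge0 => ? _.
have cA k i' j' : `|(A ^+ k) i' j'| <= c ^+ k.
  elim: k i' j' => [|k IH] i' j'.
    by rewrite !expr0 mxE; case: eqP; rewrite ?normr1 ?normr0.
  rewrite !exprS mxE (le_trans (ler_norm_sum _ _ _))//.
  apply: (@le_trans _ _ (\sum_l `|A i' l| * c ^+ k)).
    by apply: ler_sum => l _; rewrite normrM ler_wpM2l.
  rewrite -mulr_suml ler_wpM2r ?exprn_ge0//.
  by rewrite /c [leRHS](bigD1 i')//= lerDl; do 2!apply: sumr_ge0 => ? _.
apply: normed_cvg; apply: series_le_cvg (is_cvg_series_exp_coeff c) => k /=.
- exact: normr_ge0.
- by rewrite /exp_coeff/= divr_ge0 ?exprn_ge0.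
- by rewrite /exp_coeff/= normrM normfV normr_nat ler_wpM2r ?invr_ge0.
Qed.

Lemma measurable_powmx A i j : measurable_fun setT (fun r : R => powmx r A i j).
Proof.
have eA r k : ((ln r *: A) ^+ k) i j = ln r ^+ k * (A ^+ k) i j.
  suff -> : (ln r *: A) ^+ k = ln r ^+ k *: A ^+ k by rewrite mxE.
  elim: k => [|k IH]; first by rewrite !expr0 scale1r.
  by rewrite !exprS IH -[LHS]scalemxAl -scalemxAr scalerA.
apply: (@measurable_fun_cvg _ _ R setT (fun n r =>
  series (fun k => ((ln r *: A) ^+ k) i j / k`!%:R) n)).
- move=> n; apply: measurable_sum => k; apply: measurable_funM => //.
  under eq_fun do rewrite eA.
  by apply: measurable_funM => //; apply: measurable_funX; exact: measurable_ln.
- by move=> r _; rewrite /powmx /expmx mxE; exact: cvg_expmx.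
Qed.

Lemma measurable_powmx_mul A : measurable_fun setT
  (fun p : borelV R d * measurableTypeR R =>
     powmx p.2 A *m (p.1 : 'cV[R]_d) : borelV R d).
Proof.
apply: measurable_borelV => i; under eq_fun do rewrite mxE.
apply: measurable_sum => k; apply: measurable_funM.
  exact: measurableT_comp (measurable_powmx A i k) measurable_snd.
exact: measurableT_comp (measurable_coord k) measurable_fst.
Qed.

End matrix_power_measurability.

Section levy_measure.
Local Open Scope ereal_scope.
Context {R : realType} {d : nat}.
Variables (A : 'M[R]_d) (sigma : {measure set (borelV R d) -> \bar R}).

Definition levy_measure (B : set (borelV R d)) : \bar R :=
  \int[sigma]_(theta in sphere) \int[lebesgue_measure]_(r in `]0%R, +oo[)
    (\1_B (powmx r A *m (theta : 'cV[R]_d)) / r ^+ 2)%:E.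

Let kern (B : set (borelV R d)) (p : borelV R d * measurableTypeR R) : \bar R :=
  ((\1_B (powmx p.2 A *m (p.1 : 'cV[R]_d)) / p.2 ^+ 2)%:E : \bar R).

Let kern_ge0 B p : 0 <= kern B p.
Proof. by rewrite lee_fin divr_ge0// ?sqr_ge0. Qed.

Let D : set (borelV R d * measurableTypeR R) := setT `*` `]0%R, +oo[.

Let measurable_D : measurable D.
Proof. exact: measurableX. Qed.

Let measurable_kern B : measurable B -> measurable_fun D (kern B).
Proof.
move=> mB; apply/measurable_EFinP.
pose f (p : borelV R d * measurableTypeR R) : R :=
  (\1_B (powmx p.2 A *m (p.1 : 'cV[R]_d)) * expR (- ln p.2) ^+ 2)%R.
apply: (eq_measurable_fun f).
  move=> [v r]; rewrite inE => -[_ /=]; rewrite in_itv/= andbT => r0.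
  by rewrite /f /= expRN lnK ?posrE// exprVn.
apply/measurable_funTS/measurable_funM.
  exact: (measurableT_comp (@measurable_indic _ _ R setT B mB)
    (measurable_powmx_mul A)).
apply: measurable_funX; apply: measurableT_comp; first exact: measurable_expR.
apply: measurableT_comp; first exact: oppr_measurable.
by apply: measurableT_comp; [exact: measurable_ln|exact: measurable_snd].
Qed.

Let levy_measureE B : levy_measure B = \int[sigma]_(theta in sphere)
  fubini_F lebesgue_measure (fun p => (kern B \_ D) p) theta.
Proof.
apply: eq_integral => theta _; rewrite integral_mkcond; apply: eq_integral => r _.
by rewrite !patchE in_setX in_setT.
Qed.

Let measurable_restr B : measurable B -> measurable_fun setT (kern B \_ D).
Proof.
by move=> mB; apply/(measurable_restrictT _ _).1 => //; exact: measurable_kern.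
Qed.

Let restr_ge0 B p : 0 <= (kern B \_ D) p.
Proof. by rewrite patchE; case: ifP. Qed.

Let measurable_inner B : measurable B -> measurable_fun setT
  (fubini_F lebesgue_measure (fun p => (kern B \_ D) p)).
Proof.
move=> mB; apply: measurable_fun_fubini_tonelli_F => //.
exact: measurable_restr.
Qed.

Let levy_measure0 : levy_measure set0 = 0.
Proof.
by apply: integral0_eq => v _; apply: integral0_eq => r _; rewrite indic0 mul0r.
Qed.

Let levy_measure_ge0 B : 0 <= levy_measure B.
Proof.
apply: integral_ge0 => v _; apply: integral_ge0 => r _.
exact: (kern_ge0 B (v, r)).
Qed.

Let levy_measure_sigma_additive : semi_sigma_additive levy_measure.
Proof.
move=> F mF tF _.
rewrite [X in _ --> X](_ : _ = \sum_(n <oo) levy_measure (F n)).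
  by apply/cvg_closeP; split; [exact: is_cvg_nneseries|rewrite closeE].
rewrite (eq_eseriesr (fun n _ => levy_measureE (F n))).
rewrite -integral_nneseries//; last 3 first.
- exact: measurable_sphere.
- by move=> n; apply: measurable_funTS; exact: measurable_inner.
- by move=> n v _; exact: integral_ge0.
apply: eq_integral => v _; rewrite /fubini_F -integral_nneseries//; last first.
  by move=> n; exact: (measurable_fun_pair2 v (measurable_restr (mF n))).
rewrite [LHS]integral_mkcond; congr integral; apply/funext => r; rewrite patchE.
case: ifPn => r0; last first.
  by rewrite eseries0// => n _ _; rewrite patchE in_setX in_setT/= (negbTE r0).
under eq_eseriesr do rewrite patchE in_setX in_setT/= r0 /kern/= EFinM muleC.
by rewrite nneseriesZl// -indic_bigcup// -EFinM mulrC.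
Qed.

HB.instance Definition _ := isMeasure.Build _ _ _ levy_measure
  levy_measure0 levy_measure_ge0 levy_measure_sigma_additive.

Definition levy_symbol (xi : 'cV[R]_d) : \bar R :=
  \int[levy_measure]_(y in ~` [set (0 : 'cV[R]_d)%R])
    (1 - cos (inner (y : 'cV[R]_d) xi))%:E.

End levy_measure.

Section osl_symbol.
Context {R : realType} {d : nat}.

(* A finite measure on the sphere is encoded by its extension by 0 to R^d. *)
Definition spherical (sigma : set (borelV R d) -> \bar R) : Prop :=
  sigma (~` sphere) = 0%E.

Definition spherical_symmetric (sigma : set (borelV R d) -> \bar R) : Prop :=
  forall B : set (borelV R d), measurable B -> B `<=` sphere ->
    sigma B = sigma [set - (v : 'cV[R]_d) | v in B].

Definition osl_symbol (E : 'cV[R]_d -> 'M[R]_d)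
    (sigma : {measure set (borelV R d) -> \bar R}) (x xi : 'cV[R]_d) : \bar R :=
  levy_symbol (E x) sigma xi.

End osl_symbol.

(* Main.v *)
From HB Require Import structures.
Require Import Defs.
From mathcomp Require Import all_boot all_order all_algebra.
From mathcomp Require Import all_classical all_reals all_analysis.
From mathcomp Require Import measurable_realfun.
From mathcomp Require Import ring.

(** Write A for E(x) and phi for the Levy measure with exponent A. Everything
    comes from the scaling of phi under the one-parameter group t^A: since
    (s t)^A = s^A t^A, the point t^A r^A theta is (t r)^A theta, and the radial
    measure dr / r^2 is homogeneous of degree -1, so the substitution
    r |-> t r gives

      phi ((t^A)^-1 B) = t phi(B)                      (levy_measure_powmx).

    In words, the image of phi under t^A is t phi. As A is symmetric, so is
    t^A, hence <y, t^A xi> = <t^A y, xi>; thus q(x, t^A xi) is the integral of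
    y |-> 1 - cos <y, xi> against the image of phi under t^A, which is
    t q(x, xi) (levy_symbol_powmx). The integrand vanishes at the origin, so
    the punctured space can be replaced by the whole space, which is its own
    preimage under t^A (levy_symbolT).

    Two ingredients are built on the way. The first is the functional equation
    exp (A + B) = exp A exp B for commuting matrices (expmxD). It is a Cauchy
    product, and it is obtained by comparison with the scalar exponential: for
    double arrays dominated by a scalar array, the gap between the sum over
    the square j, i < n and the sum over the triangle j + i < n is at most
    that of the scalar array, and for the scalar array a^j b^i / (j! i!) this
    gap tends to 0 because both sums tend to e^(a + b). The second is the
    behaviour of Lebesgue measure under dilations (ge0_integral_dilation), for
    integrands that are only measurable and nonnegative, since indicators of
    Borel sets have to be allowed. *)

Import Order.TTheory GRing.Theory Num.Theory.
Import numFieldNormedType.Exports.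

Set Implicit Arguments.
Unset Strict Implicit.
Unset Printing Implicit Defensive.

Local Open Scope classical_set_scope.
Local Open Scope ring_scope.

(** * Square and triangular sums of a double array *)

Definition square_sum (V : nmodType) (w : nat -> nat -> V) n : V :=
  \sum_(0 <= i < n) \sum_(0 <= j < n) w j i.

Definition triangle_sum (V : nmodType) (w : nat -> nat -> V) n : V :=
  \sum_(0 <= m < n) \sum_(0 <= i < m.+1) w (m - i)%N i.

Lemma triangle_sum_columns (V : nmodType) (w : nat -> nat -> V) n :
  triangle_sum w n = \sum_(0 <= i < n) \sum_(0 <= j < n - i) w j i.
Proof.
rewrite /triangle_sum; elim: n => [|n IH]; first by rewrite !big_geq.
rewrite big_nat_recr//= IH [in RHS]big_nat_recr//= subSnn big_nat1.
rewrite big_nat_recr//= subnn addrA -big_split/=; congr (_ + _).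
by apply: eq_big_nat => i /andP[_ lin]; rewrite subSn 1?ltnW// big_nat_recr.
Qed.

(** The gap is itself the sum over the corner j, i < n <= j + i of the square,
    where domination applies term by term. *)
Lemma ler_norm_square_sub_triangle (R : realDomainType)
    (w z : nat -> nat -> R) n : (forall j i, `|w j i| <= z j i) ->
  `|square_sum w n - triangle_sum w n| <= square_sum z n - triangle_sum z n.
Proof.
move=> wz.
have E v : square_sum v n - triangle_sum v n =
    \sum_(0 <= i < n) \sum_(n - i <= j < n) v j i :> R.
  rewrite triangle_sum_columns -sumrB; apply: eq_bigr => i _.
  by rewrite (@big_cat_nat _ _ _ (n - i) 0 n)//= ?leq_subr// addrAC subrr add0r.
rewrite !E (le_trans (ler_norm_sum _ _ _))//; apply: ler_sum => i _.
by rewrite (le_trans (ler_norm_sum _ _ _))//; exact: ler_sum.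
Qed.

(** With v j i = x^j y^i, the left-hand side is the m-th term of the exponential
    series of x + y: this turns that series into a triangular sum. *)
Lemma exp_term_binomial (F : numFieldType) (v : nat -> nat -> F) m :
  (\sum_(0 <= i < m.+1) v (m - i)%N i *+ 'C(m, i)) / m`!%:R =
  \sum_(0 <= i < m.+1) v (m - i)%N i / ((m - i)`! * i`!)%:R.
Proof.
rewrite big_distrl/=; apply: eq_big_nat => i /andP[_ im].
have f0 k : k`!%:R != 0 :> F by rewrite pnatr_eq0 -lt0n fact_gt0.
rewrite -(bin_fact (_ : i <= m)%N)// -mulr_natr !natrM.
have b0 : 'C(m, i)%:R != 0 :> F by rewrite pnatr_eq0 -lt0n bin_gt0.
by field; rewrite b0 !f0.
Qed.

(** * Functional equation of the matrix exponential *)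

Section matrix_exponential.
Context {R : realType} {d : nat}.
Implicit Types A B : 'M[R]_d.

Lemma ler_norm_mxX A k i j : `|(A ^+ k) i j| <= (\sum_p \sum_l `|A p l|) ^+ k.
Proof.
elim: k i j => [|k IH] i j.
  by rewrite !expr0 mxE; case: eqP; rewrite ?normr1 ?normr0.
set c := \sum_p _.
rewrite !exprS mxE (le_trans (ler_norm_sum _ _ _))//.
apply: (@le_trans _ _ (\sum_l `|A i l| * c ^+ k)).
  by apply: ler_sum => l _; rewrite normrM ler_wpM2l.
rewrite -mulr_suml ler_wpM2r ?exprn_ge0//.
  by do 2!apply: sumr_ge0 => ? _.
by rewrite /c [leRHS](bigD1 i)//= lerDl; do 2!apply: sumr_ge0 => ? _.
Qed.

Lemma expmxE A i j :
  series (fun k => (A ^+ k) i j / k`!%:R) @ \oo --> expmx A i j.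
Proof. by rewrite /expmx mxE; exact: cvg_expmx. Qed.

(** Entry by entry, the partial sums of exp (A + B) are triangular sums of the
    array (A^j B^i) / (j! i!), and the products of the partial sums of exp A and
    exp B are its square sums. *)
Lemma expmxD A B : A *m B = B *m A -> expmx (A + B) = expmx A *m expmx B.
Proof.
move=> AB; apply/matrixP => k l; rewrite [RHS]mxE.
pose a : R := \sum_p \sum_q `|A p q|; pose b : R := \sum_p \sum_q `|B p q|.
(* An entry of A^j B^i is a sum of d products, whence the factor c. *)
pose c : R := d%:R.
pose w j i := (A ^+ j *m B ^+ i) k l / (j`! * i`!)%:R.
pose z j i := c * (a ^+ j * b ^+ i / (j`! * i`!)%:R).
have wz j i : `|w j i| <= z j i.
  rewrite /z normrM normfV normr_nat mulrA ler_wpM2r ?invr_ge0//.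
  rewrite mxE (le_trans (ler_norm_sum _ _ _))//.
  rewrite -[X in X * _](_ : \sum_(p < d) 1 = c); last first.
    by rewrite sumr_const card_ord.
  rewrite mulr_suml; apply: ler_sum => p _; rewrite mul1r normrM.
  by rewrite ler_pM// ler_norm_mxX.
have triw : triangle_sum w @ \oo --> expmx (A + B) k l.
  rewrite (_ : triangle_sum w = series (fun m => ((A + B) ^+ m) k l / m`!%:R)).
    exact: expmxE.
  apply/funext => n; rewrite /series/=; apply: eq_bigr => m _.
  rewrite -(exp_term_binomial (fun j i => (A ^+ j *m B ^+ i) k l)).
  rewrite exprDn_comm// summxE big_mkord.
  by congr (_ / _); apply: eq_bigr => i _; rewrite mulmxnE.
have sqw : square_sum w @ \oo --> \sum_p expmx A k p * expmx B p l.
  rewrite (_ : square_sum w = fun n => \sum_p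
      series (fun m => (A ^+ m) k p / m`!%:R) n *
      series (fun m => (B ^+ m) p l / m`!%:R) n).
    apply: cvg_big => [|p _]; first exact: add_continuous.
    by apply: cvgM; exact: expmxE.
  apply/funext => n; rewrite /series/=.
  under [RHS]eq_bigr do rewrite mulr_sumr.
  rewrite [RHS]exchange_big/=; apply: eq_bigr => i _.
  under [RHS]eq_bigr do rewrite mulr_suml.
  rewrite [RHS]exchange_big/=; apply: eq_bigr => j _.
  rewrite /w mxE mulr_suml; apply: eq_bigr => p _.
  by rewrite natrM invfM mulrACA.
have triz : triangle_sum z @ \oo --> c * expR (a + b).
  rewrite (_ : triangle_sum z = fun n => c * series (exp_coeff (a + b)) n).
    by apply: cvgMl_tmp; exact: is_cvg_series_exp_coeff.
  apply/funext => n; rewrite /series/= mulr_sumr; apply: eq_bigr => m _.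
  rewrite -mulr_sumr -(exp_term_binomial (fun j i => a ^+ j * b ^+ i)).
  by rewrite /exp_coeff/= exprDn big_mkord.
have sqz : square_sum z @ \oo --> c * expR (a + b).
  rewrite (_ : square_sum z = fun n => c *
     (series (exp_coeff a) n * series (exp_coeff b) n)).
    rewrite expRD; apply: cvgMl_tmp.
    by apply: cvgM; exact: is_cvg_series_exp_coeff.
  apply/funext => n; rewrite /series/= mulr_sumr mulr_sumr.
  apply: eq_bigr => i _; rewrite mulr_suml mulr_sumr; apply: eq_bigr => j _.
  by rewrite /z /exp_coeff/= natrM invfM mulrACA.
(* Hence the square and triangular sums of w have the same limit. *)
have dif0 : square_sum w n - triangle_sum w n @[n --> \oo] --> (0 : R).
  apply/norm_cvg0P.
  apply: (@squeeze_cvgr _ _ _ _ (cst 0)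
    (fun n => square_sum z n - triangle_sum z n)).
  - near=> n; rewrite normr_ge0/=; exact: ler_norm_square_sub_triangle.
  - exact: cvg_cst.
  - by rewrite -(subrr (c * expR (a + b))); apply: cvgB.
apply/esym/subr0_eq; apply: (cvg_unique _ _ dif0) => //.
exact: cvgB.
Unshelve. all: by end_near.
Qed.

Lemma trmx_expmx A : (expmx A)^T = expmx A^T.
Proof.
have trX k : (A ^+ k)^T = A^T ^+ k.
  elim: k => [|k IH]; first by rewrite !expr0 trmx1.
  by rewrite exprS exprSr -IH; exact: trmx_mul.
apply/matrixP => i j; rewrite !mxE; congr (limn (series _)).
by apply/funext => k; rewrite -trX mxE.
Qed.

Lemma powmxM A s t : 0 < s -> 0 < t ->
  powmx (s * t) A = powmx s A *m powmx t A.
Proof.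
move=> s0 t0; rewrite /powmx lnM ?posrE// scalerDl expmxD//.
by rewrite -!scalemxAl -!scalemxAr scalerA mulrC -scalerA.
Qed.

Lemma trmx_powmx A t : (powmx t A)^T = powmx t A^T.
Proof. by rewrite trmx_expmx linearZ. Qed.

Lemma inner_mulmx A (u v : 'cV[R]_d) : inner u (A *m v) = inner (A^T *m u) v.
Proof.
suff innerE (x y : 'cV[R]_d) : inner x y = (x^T *m y) ord0 ord0.
  by rewrite !innerE trmx_mul trmxK mulmxA.
by rewrite mxE; apply: eq_bigr => i _; rewrite mxE.
Qed.

End matrix_exponential.

(** * Lebesgue measure under dilations *)

Section dilation.
Local Open Scope ereal_scope.
Context {R : realType}.
Variables (c : R) (c0 : (0 < c)%R).

Let dilate : measurableTypeR R -> measurableTypeR R := *%R c.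

Let measurable_dilate : measurable_fun setT dilate.
Proof. exact: measurable_funM. Qed.

HB.instance Definition _ :=
  isMeasurableFun.Build _ _ _ _ dilate measurable_dilate.

(** Both sides are measures in A, and they agree on half-open intervals. *)
Lemma lebesgue_measure_dilation (A : set R) : measurable A ->
  lebesgue_measure A = c%:E * lebesgue_measure ( *%R c @^-1` A).
Proof.
move=> mA.
have cnneg : (0 <= c)%R by exact: ltW.
apply: (@lebesgue_measure_unique R
  (mscale (NngNum cnneg) (pushforward lebesgue_measure dilate))) => //.
move=> _ [[a b]] _ <-/=.
rewrite /mscale/= /pushforward.
rewrite (_ : dilate @^-1` _ = `]c^-1 * a, c^-1 * b]%classic)%R; last first.
  apply/seteqP; split => r /=; rewrite !in_itv/= /dilate;
    by rewrite ltr_pdivrMl// ler_pdivlMl.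
rewrite !lebesgue_measure_itv/= !lte_fin ltr_pM2l ?invr_gt0//.
case: ifP => _; last by rewrite mule0.
by rewrite -!EFinD -EFinM -mulrBr mulrA divff ?gt_eqF// mul1r.
Qed.

Lemma ge0_integral_dilation (f : measurableTypeR R -> \bar R) :
  measurable_fun setT f -> (forall r, 0 <= f r) ->
  \int[lebesgue_measure]_(r in `]0%R, +oo[) f r =
  c%:E * \int[lebesgue_measure]_(r in `]0%R, +oo[) f (c * r)%R.
Proof.
move=> mf f0.
have cnneg : (0 <= c)%R by exact: ltW.
rewrite (eq_measure_integral
  (mscale (NngNum cnneg) (pushforward lebesgue_measure dilate)));
  last by move=> A mA _; exact: lebesgue_measure_dilation.
rewrite ge0_integral_mscale//=; last exact: measurable_funTS.
rewrite ge0_integral_pushforward//=; last exact: measurable_funTS.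
congr (_ * integral _ _ _); apply/seteqP; split => r /=;
  by rewrite !in_itv/= !andbT /dilate pmulr_rgt0.
Qed.

End dilation.

(** * Scaling of the Levy measure *)

Section levy_measure_scaling.
Local Open Scope ereal_scope.
Context {R : realType} {d : nat}.
Variables (A : 'M[R]_d) (sigma : {measure set (borelV R d) -> \bar R}).

(** The integrand of the Levy measure in polar coordinates (theta, r). The
    factor 1 / r^2 is written as the square of exp (- ln r), with the same value
    for 0 < r, so that joint measurability on the whole space reduces to that
    of exp and ln. *)
Definition polar_density (B : set (borelV R d))
    (p : borelV R d * measurableTypeR R) : \bar R :=
  (\1_B (powmx p.2 A *m (p.1 : 'cV[R]_d)) * expR (- ln p.2) ^+ 2)%:E.

Lemma polar_density_ge0 B p : 0 <= polar_density B p.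
Proof. by rewrite lee_fin mulr_ge0// sqr_ge0. Qed.

Lemma measurable_polar_density B : measurable B ->
  measurable_fun setT (polar_density B).
Proof.
move=> mB; apply/measurable_EFinP; apply: measurable_funM.
  exact: (measurableT_comp (@measurable_indic _ _ R setT B mB)
    (measurable_powmx_mul A)).
apply: measurable_funX; apply: measurableT_comp; first exact: measurable_expR.
apply: measurableT_comp; first exact: oppr_measurable.
by apply: measurableT_comp; [exact: measurable_ln|exact: measurable_snd].
Qed.

Lemma polar_densityE B (v : 'cV[R]_d) (r : R) : (0 < r)%R ->
  polar_density B (v, r) = (\1_B (powmx r A *m v) / r ^+ 2)%:E.
Proof. by move=> r0; rewrite /polar_density expRN lnK ?posrE// exprVn. Qed.

Definition radial_mass (B : set (borelV R d)) (v : borelV R d) : \bar R :=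
  \int[lebesgue_measure]_(r in `]0%R, +oo[) polar_density B (v, r).

Lemma levy_measureE B :
  levy_measure A sigma B = \int[sigma]_(v in sphere) radial_mass B v.
Proof.
apply: eq_integral => v _; apply: eq_integral => r.
by rewrite inE/= in_itv/= andbT => r0; rewrite polar_densityE.
Qed.

Lemma radial_mass_ge0 B v : 0 <= radial_mass B v.
Proof. by apply: integral_ge0 => r _; exact: polar_density_ge0. Qed.

Lemma measurable_radial_mass B : measurable B ->
  measurable_fun setT (radial_mass B).
Proof.
move=> mB.
pose D : set (borelV R d * measurableTypeR R) := setT `*` `]0%R, +oo[.
rewrite (_ : radial_mass B =
    fubini_F lebesgue_measure (polar_density B \_ D)).
  apply: measurable_fun_fubini_tonelli_F; last first.
    by move=> p; rewrite patchE; case: ifP => // _; exact: polar_density_ge0.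
  apply/(measurable_restrictT _ _).1; first exact: measurableX.
  by apply: measurable_funTS; exact: measurable_polar_density.
apply/funext => v; rewrite /radial_mass integral_mkcond.
apply: eq_integral => r _.
by rewrite !patchE in_setX in_setT.
Qed.

(** The substitution r |-> t r: the indicator at t^A r^A v is the one at
    (t r)^A v, while 1 / r^2 = t^2 / (t r)^2 leaves one factor t after the
    Jacobian. *)
Lemma radial_mass_powmx (B : set (borelV R d)) (t : R) v :
    (0 < t)%R -> measurable B ->
  radial_mass [set w : borelV R d | B (powmx t A *m (w : 'cV[R]_d))] v =
  t%:E * radial_mass B v.
Proof.
move=> t0 mB.
have mBv : measurable_fun setT (fun r => polar_density B (v, r)).
  exact: (measurable_fun_pair2 v (measurable_polar_density mB)).
rewrite [in RHS]/radial_mass (ge0_integral_dilation t0 mBv); last first.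
  by move=> r; exact: polar_density_ge0.
rewrite muleA -EFinM -expr2 -ge0_integralZl_EFin//.
- apply: eq_integral => r; rewrite inE/= in_itv/= andbT => r0.
  rewrite !polar_densityE ?mulr_gt0// powmxM// -EFinM -mulmxA.
  rewrite exprMn [in RHS]mulrCA; congr (_ * _)%:E.
  by rewrite [in RHS]invfM mulVKf// expf_neq0// gt_eqF.
- by move=> r _; exact: polar_density_ge0.
- apply: measurable_funTS; apply: (measurableT_comp mBv).
  exact: measurable_funM.
- exact: sqr_ge0.
Qed.

Lemma levy_measure_powmx (B : set (borelV R d)) (t : R) :
    (0 < t)%R -> measurable B ->
  levy_measure A sigma [set w : borelV R d | B (powmx t A *m (w : 'cV[R]_d))] =
  t%:E * levy_measure A sigma B.
Proof.
move=> t0 mB; rewrite !levy_measureE.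
rewrite -ge0_integralZl_EFin//; last 4 first.
- exact: measurable_sphere.
- by move=> v _; exact: radial_mass_ge0.
- by apply: measurable_funTS; exact: measurable_radial_mass.
- exact: ltW.
by apply: eq_integral => v _; exact: radial_mass_powmx.
Qed.

Lemma measurable_mulmx : measurable_fun setT
  (fun v : borelV R d => A *m (v : 'cV[R]_d) : borelV R d).
Proof.
apply: measurable_borelV => i; under eq_fun do rewrite mxE.
apply: measurable_sum => k; apply: measurable_funM => //.
exact: measurable_coord.
Qed.

End levy_measure_scaling.

(** * Scaling of the symbol *)

Section levy_symbol_scaling.
Local Open Scope ereal_scope.
Context {R : realType} {d : nat}.
Variables (A : 'M[R]_d) (sigma : {measure set (borelV R d) -> \bar R}).

Lemma levy_symbolT xi : levy_symbol A sigma xi =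
  \int[levy_measure A sigma]_y (1 - cos (inner (y : 'cV[R]_d) xi))%:E.
Proof.
rewrite /levy_symbol integral_mkcond; apply: eq_integral => y _.
rewrite patchE; case: ifPn => //; rewrite in_setC negbK inE => /= ->.
rewrite [inner _ _]big1 ?cos0 ?subrr// => i _.
by rewrite mxE mul0r.
Qed.

Lemma measurable_one_sub_cos (xi : 'cV[R]_d) : measurable_fun setT
  (fun y : borelV R d => (1 - cos (inner (y : 'cV[R]_d) xi))%:E : \bar R).
Proof.
apply/measurable_EFinP; apply: measurable_funB => //.
apply: measurableT_comp.
  by apply: continuous_measurable_fun; exact: continuous_cos.
apply: measurable_sum => i; apply: measurable_funM => //.
exact: measurable_coord.
Qed.

(** The symmetry of A moves t^A to the integration variable, where it acts by
    image measure. *)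
Lemma levy_symbol_powmx (t : R) (xi : 'cV[R]_d) : A^T = A -> (0 < t)%R ->
  levy_symbol A sigma (powmx t A *m xi) = t%:E * levy_symbol A sigma xi.
Proof.
move=> symA t0; rewrite !levy_symbolT.
have tnneg : (0 <= t)%R by exact: ltW.
have f0 (y : borelV R d) : 0 <= (1 - cos (inner (y : 'cV[R]_d) xi))%:E.
  by rewrite lee_fin subr_ge0 cos_le1.
under eq_integral do rewrite inner_mulmx trmx_powmx symA.
have mT := measurable_mulmx (powmx t A).
have mf := measurable_one_sub_cos xi.
rewrite -(ge0_integral_mscale _ measurableT (NngNum tnneg) mf)//.
rewrite -(@ge0_integral_pushforward _ _ _ _ _ _ mT _ setT _ _ mf)//.
by apply: eq_measure_integral => B mB _; exact: levy_measure_powmx.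
Qed.

End levy_symbol_scaling.

Theorem theorem2p23 (R : realType) (d : nat) (E : 'cV[R]_d -> 'M[R]_d)
    (sigma : {finite_measure set (borelV R d) -> \bar R})
    (hE : admissible E)
    (hsigma : spherical sigma)
    (hsym : spherical_symmetric sigma)
    (t : R) (ht : 0 < t) (x xi : 'cV[R]_d) :
  osl_symbol E sigma x (powmx t (E x) *m xi) = (t%:E * osl_symbol E sigma x xi)%E.
Proof. exact: levy_symbol_powmx (admissible_sym hE x) ht. Qed.
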